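(* Let $X,Y\in\mathbb{R}^{n\times k}$ with $Y_{i,j}\sim\mathcal{N}(X_{i,j},\sigma^2)$ independent, and let $P\in\mathbb{R}^{n\times n}$ and $Q\in\mathbb{R}^{k\times k}$ be two orthogonal matrices. For $\Theta\in\mathbb{R}^{n\times k}$ let $$\operatorname{SURE}_\Theta(Y)=\|(\Theta-\mathbf{1}_n\mathbf{1}_k^\top)\odot PYQ\|_F^2+2\sigma^2\langle\Theta,\mathbf{1}_n\mathbf{1}_k^\top\rangle_F-nk\sigma^2 .$$ Then $$\mathop{\arg\min}_{\Theta\in\mathbb{R}^{n\times k}}\operatorname{SURE}_\Theta(Y)=\mathbf{1}_n\mathbf{1}_k^\top-\frac{\sigma^2}{(PYQ)^{\odot2}},$$ and $$\mathop{\arg\min}_{\Theta\in\{0,1\}^{n\times k}}\operatorname{SURE}_\Theta(Y)=\mathbb{1}_{\mathbb{R}\setminus[-\sqrt2\sigma,\sqrt2\sigma]}(PYQ).$$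
   Context: $\sigma>0$. $\odot$ is the entrywise product, $A^{\odot2}=A\odot A$, and the division is entrywise. $\|\cdot\|_F$ and $\langle A,B\rangle_F=\operatorname{tr}(A^\top B)$ are the Frobenius norm and inner product; $\mathbf{1}_m$ is the all-ones vector in $\mathbb{R}^m$. $\mathbb{1}_S$ is the indicator function of the set $S\subset\mathbb{R}$, applied entrywise, so $\mathbb{1}_{\mathbb{R}\setminus[-\sqrt2\sigma,\sqrt2\sigma]}(PYQ)$ is the matrix whose $(i,j)$ entry is $1$ if $|(PYQ)_{i,j}|>\sqrt2\sigma$ and $0$ otherwise. $\operatorname{SURE}_\Theta(Y)$ is Stein's unbiased estimate of the quadratic risk $\mathbb{E}\|f_\Theta(Y)-X\|_F^2$ of the denoiser $f_\Theta(Y)=P^{-1}(\Theta\odot(PYQ))Q^{-1}$. *)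

(* Defs.v *)
From HB Require Import structures.
From mathcomp Require Import all_boot all_order all_algebra.
From mathcomp Require Import all_classical all_reals all_analysis.

Set Implicit Arguments.
Unset Strict Implicit.
Unset Printing Implicit Defensive.
Import Order.TTheory GRing.Theory Num.Theory.
Import numFieldNormedType.Exports.
Local Open Scope classical_set_scope.
Local Open Scope ring_scope.

Definition hadamard (R : realType) (m n : nat) (A B : 'M[R]_(m, n)) :
  'M[R]_(m, n) := map2_mx *%R A B.

Definition frob_inner (R : realType) (m n : nat) (A B : 'M[R]_(m, n)) : R :=
  \tr (A^T *m B).

Definition frob_norm (R : realType) (m n : nat) (A : 'M[R]_(m, n)) : R :=
  Num.sqrt (frob_inner A A).

Definition orthogonal_mx (R : realType) (n : nat) (A : 'M[R]_n) : Prop :=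
  A^T *m A = 1%:M.

Definition ones (R : realType) (m : nat) : 'cV[R]_m := const_mx 1.

Definition SURE (R : realType) (n k : nat) (sigma : R) (U : 'M[R]_n)
    (V : 'M[R]_k) (Theta Y : 'M[R]_(n, k)) : R :=
  frob_norm (hadamard (Theta - ones R n *m (ones R k)^T) (U *m Y *m V)) ^+ 2
  + 2 * sigma ^+ 2 * frob_inner Theta (ones R n *m (ones R k)^T)
  - n%:R * k%:R * sigma ^+ 2.

Definition argmin (T : Type) (R : realType) (D : set T) (f : T -> R) : set T :=
  [set x | D x /\ forall y, D y -> f x <= f y].

Definition binary_mx (R : realType) (m n : nat) : set 'M[R]_(m, n) :=
  [set A | forall i j, A i j = 0 \/ A i j = 1].

(* The laws are compared on measurable sets only, since a measure is
   unconstrained on the other sets. *)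
Definition normal_rv (d : measure_display) (T : measurableType d)
    (R : realType) (P : probability T R) (Z : {RV P >-> R}) (m s : R) : Prop :=
  forall A : set R, measurable A -> distribution P Z A = normal_prob m s A.

Definition mutually_independent (d : measure_display) (T : measurableType d)
    (R : realType) (P : probability T R) (I : finType)
    (Z : I -> {RV P >-> R}) : Prop :=
  forall (J : {set I}) (A : I -> set R), (forall i, measurable (A i)) ->
    P (\bigcap_(i in [set` J]) (Z i @^-1` A i)) =
    (\prod_(i in J) P (Z i @^-1` A i))%E.

Definition realization (d : measure_display) (T : measurableType d)
    (R : realType) (P : probability T R) (n k : nat)
    (Y : 'I_n -> 'I_k -> {RV P >-> R}) (w : T) : 'M[R]_(n, k) :=
  \matrix_(i, j) Y i j w.

(* Main.v *)
(* SURE splits into a sum over the entries y of PYQ of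
   (x - 1)^2 y^2 + 2 sigma^2 x - sigma^2, so it is minimized entry by entry: over
   the reals at x = 1 - sigma^2 / y^2, uniquely if y != 0; over {0, 1} by comparing
   y^2 with 2 sigma^2, uniquely if |y| != sqrt 2 sigma.

   The exceptional values of y are almost surely avoided, because y is a linear
   combination of independent Gaussians with a nonzero coefficient on some Y_0.
   To see that such a combination has no atom, cut the space into countably many
   cells by rounding all variables but Y_0 to multiples of h. On a cell, the event
   that the combination equals t forces Y_0 into an interval of length O(h), which
   is independent of the cell; summing over the cells bounds the probability by
   O(h), since Gaussian densities are bounded. *)
Require Import Defs.
From HB Require Import structures.
From mathcomp Require Import all_boot all_order all_algebra.
From mathcomp Require Import all_classical all_reals all_analysis.
From mathcomp Require Import measurable_realfun ring lra.

Set Implicit Arguments.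
Unset Strict Implicit.
Unset Printing Implicit Defensive.
Import Order.TTheory GRing.Theory Num.Theory.
Import numFieldNormedType.Exports.
Local Open Scope classical_set_scope.
Local Open Scope ring_scope.

(** * Reduction of SURE to its entries *)

Lemma frob_innerE (R : realType) (m n : nat) (A B : 'M[R]_(m, n)) :
  frob_inner A B = \sum_i \sum_j A i j * B i j.
Proof.
rewrite /frob_inner /mxtrace exchange_big; apply: eq_bigr => j _.
by rewrite !mxE; apply: eq_bigr => i _; rewrite mxE.
Qed.

Lemma frob_norm_sqr (R : realType) (m n : nat) (A : 'M[R]_(m, n)) :
  frob_norm A ^+ 2 = frob_inner A A.
Proof.
rewrite sqr_sqrtr // frob_innerE; apply: sumr_ge0 => i _; apply: sumr_ge0 => j _.
by rewrite -expr2 sqr_ge0.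
Qed.

Lemma ones_outerE (R : realType) (n k : nat) (i : 'I_n) (j : 'I_k) :
  (ones R n *m (ones R k)^T) i j = 1.
Proof. by rewrite !mxE big_ord1 !mxE mulr1. Qed.

Lemma ones_outerB (R : realType) (n k : nat) (A : 'M[R]_(n, k)) i j :
  (A - ones R n *m (ones R k)^T) i j = A i j - 1.
Proof. by rewrite mxE [X in _ + X = _]mxE ones_outerE. Qed.

Definition entry_SURE (R : realType) (sigma y x : R) : R :=
  (x - 1) ^+ 2 * y ^+ 2 + 2 * sigma ^+ 2 * x - sigma ^+ 2.

Lemma SURE_sum (R : realType) (n k : nat) (sigma : R) (U : 'M[R]_n)
    (V : 'M[R]_k) (Theta Y : 'M[R]_(n, k)) :
  SURE sigma U V Theta Y =
  \sum_i \sum_j entry_SURE sigma ((U *m Y *m V) i j) (Theta i j).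
Proof.
rewrite /entry_SURE /SURE frob_norm_sqr !frob_innerE.
set M := U *m Y *m V.
have -> : n%:R * k%:R * sigma ^+ 2 = \sum_(i < n) \sum_(j < k) sigma ^+ 2.
  by rewrite !sumr_const !card_ord -mulrA !mulr_natl.
rewrite mulr_sumr -big_split -sumrB; apply: eq_bigr => i _ /=.
rewrite mulr_sumr -big_split -sumrB; apply: eq_bigr => j _ /=.
move: M => M; rewrite ones_outerE mxE ones_outerB; ring.
Qed.

(** * Entrywise minimization *)

(** Termwise comparison shows that [m] is optimal; a competitor differing from [m] at one entry is
    strictly worse in that term and no better in the others. *)
Lemma argmin_separable (R : realType) (n k : nat) (D : set R)
    (g : 'I_n -> 'I_k -> R -> R) (f : 'M[R]_(n, k) -> R) (m : 'M[R]_(n, k)) :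
  (forall A, f A = \sum_i \sum_j g i j (A i j)) ->
  (forall i j, D (m i j)) ->
  (forall i j x, D x -> x != m i j -> g i j (m i j) < g i j x) ->
  argmin [set A : 'M[R]_(n, k) | forall i j, D (A i j)] f = [set m].
Proof.
move=> fE Dm gm.
have gle i j x : D x -> g i j (m i j) <= g i j x.
  by have [->//|xm Dx] := eqVneq x (m i j); exact: ltW (gm i j x Dx xm).
apply/seteqP; split => [A /= [DA Amin]|A -> /=]; last first.
  split => // B DB; rewrite !fE.
  by apply: ler_sum => i _; apply: ler_sum => j _; exact: gle.
apply/matrixP => i j; apply/eqP/negPn/negP => Am.
suff : f m < f A by apply/negP; rewrite -leNgt Amin.
rewrite !fE !pair_big (bigD1 (i, j)) //= [ltRHS](bigD1 (i, j)) //=.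
by apply: ltr_leD; [exact: gm|apply: ler_sum => p _; exact: gle].
Qed.

Lemma argmin_SURE_setT (R : realType) (n k : nat) (sigma : R) (U : 'M[R]_n)
    (V : 'M[R]_k) (Y : 'M[R]_(n, k)) :
  (forall i j, (U *m Y *m V) i j != 0) ->
  argmin setT (fun Theta => SURE sigma U V Theta Y) =
    [set ones R n *m (ones R k)^T -
         map_mx (fun y => sigma ^+ 2 / y)
           (hadamard (U *m Y *m V) (U *m Y *m V))].
Proof.
move=> M0; have -> : [set: 'M[R]_(n, k)] =
    [set A : 'M[R]_(n, k) | forall i j, [set: R] (A i j)].
  by apply/seteqP; split.
apply: (@argmin_separable _ _ _ _
  (fun i j => entry_SURE sigma ((U *m Y *m V) i j)))
  => [A||i j x _]; [exact: SURE_sum|by []|].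
rewrite mxE [X in _ + X]mxE ones_outerE [map_mx _ _ i j]mxE.
rewrite [hadamard _ _ i j]mxE /entry_SURE; have := M0 i j.
set y := (U *m Y *m V) i j => y0 xm.
(* Completing the square: this quantity is exactly the excess of the objective at [x] over its value
   at the claimed minimizer. *)
have : 0 < ((x - (1 - sigma ^+ 2 / (y * y))) * y) ^+ 2.
  by rewrite exprn_even_gt0 //= mulf_neq0 // subr_eq0.
move=> sq; rewrite -subr_gt0; move: sq; congr (_ < _); field; exact: y0.
Qed.

Lemma argmin_SURE_binary (R : realType) (n k : nat) (sigma : R) (U : 'M[R]_n)
    (V : 'M[R]_k) (Y : 'M[R]_(n, k)) :
  0 < sigma ->
  (forall i j, `|(U *m Y *m V) i j| != Num.sqrt 2 * sigma) ->
  argmin (@binary_mx R n k) (fun Theta => SURE sigma U V Theta Y) =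
    [set map_mx (\1_(~` `[- (Num.sqrt 2 * sigma), Num.sqrt 2 * sigma]%classic))
           (U *m Y *m V)].
Proof.
move=> s0 Mtie.
apply: (@argmin_separable _ _ _ [set x | x = 0 \/ x = 1]
  (fun i j => entry_SURE sigma ((U *m Y *m V) i j))) => [A|i j|i j x].
- exact: SURE_sum.
- by rewrite mxE indicE; case: (_ \in _); [right|left].
rewrite mxE /entry_SURE; have := Mtie i j.
set y := (U *m Y *m V) i j => ytie.
have s2 : 0 <= Num.sqrt 2 * sigma by rewrite mulr_ge0 ?sqrtr_ge0 // ltW.
have sE : 2 * sigma ^+ 2 = (Num.sqrt 2 * sigma) ^+ 2.
  by rewrite exprMn sqr_sqrtr.
rewrite indicE in_setC mem_setE in_itv /= -ler_norml sE.
move: ytie; rewrite -[y ^+ 2]real_normK ?num_real //.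
(* Up to the common term [- sigma ^+ 2], the choice 0 costs [y ^+ 2] and the choice 1 costs
   [2 * sigma ^+ 2]. *)
case: (ltgtP `|y|) => //= ylt _ [->|->]; rewrite ?eqxx //= => _.
- rewrite -subr_gt0.
  have : 0 < (Num.sqrt 2 * sigma) ^+ 2 - `|y| ^+ 2.
    by rewrite subr_gt0 ltr_pXn2r // nnegrE.
  by congr (_ < _); ring.
- rewrite -subr_gt0.
  have : 0 < `|y| ^+ 2 - (Num.sqrt 2 * sigma) ^+ 2.
    by rewrite subr_gt0 ltr_pXn2r // nnegrE.
  by congr (_ < _); ring.
Qed.

(** * Linear combinations of independent variables without atoms *)

Lemma prode_setT_D1 (I : finType) (R : realType) (f : I -> \bar R) (i0 : I) :
  (\prod_(i in [set: I]%SET) f i = f i0 * \prod_(i | i != i0) f i)%E.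
Proof.
rewrite (bigD1 i0) //=.
by congr (_ * _)%E; apply: eq_bigl => i; rewrite finset.in_setT.
Qed.

(** The density never exceeds its peak, and the interval has length [2 * r]. *)
Lemma normal_prob_itv_le (R : realType) (m s a r : R) : s != 0 -> 0 <= r ->
  (normal_prob m s `[(a - r)%R, (a + r)%R]%classic <=
   (normal_peak s * (2 * r))%:E)%E.
Proof.
move=> s0 r0; rewrite /normal_prob.
apply: (@le_trans _ _ (\int[lebesgue_measure]_(x in `[(a - r)%R, (a + r)%R]%classic)
    (normal_peak s)%:E)%E).
  apply: ge0_le_integral => //=.
  - by move=> x _; rewrite lee_fin normal_pdf_ge0.
  - by apply/measurable_EFinP/measurable_funTS; exact: measurable_normal_pdf.
  - by move=> x _; rewrite lee_fin normal_pdf_ub.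
rewrite integral_cst //= EFinM lebesgue_measure_itv /= lte_fin.
apply: lee_wpmul2l; first by rewrite lee_fin normal_peak_ge0.
case: ifP => _; last by rewrite lee_fin mulr_ge0.
by rewrite -EFinB lee_fin; lra.
Qed.

Lemma measurable_linear_combination_level (R : realType) (d : measure_display)
    (T : measurableType d) (P : probability T R) (I : finType)
    (Z : I -> {RV P >-> R}) (c : I -> R) (t : R) :
  measurable [set w | \sum_i c i * Z i w = t].
Proof.
have mf : measurable_fun setT (fun w => \sum_i c i * Z i w).
  by apply: measurable_sum => i; apply: measurable_funM.
by have := mf measurableT [set t] (measurable_set1 t); rewrite setTI.
Qed.

Section concentrated_combination.
Context (R : realType) (d : measure_display) (T : measurableType d)
  (P : probability T R) (I : finType) (Z : I -> {RV P >-> R}) (i0 : I) (K : R)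
  (c : I -> R) (t : R).
Context (indepZ : mutually_independent Z) (K_ge0 : 0 <= K)
  (Z_conc : forall a r : R, 0 <= r ->
    (P (Z i0 @^-1` `[(a - r)%R, (a + r)%R]%classic) <= (K * r)%:E)%E)
  (c_neq0 : c i0 != 0).

Let level : set T := [set w | \sum_i c i * Z i w = t].

(** Amplification factor: changing every other variable by at most [h] moves the solution of the
    level equation for [Z i0] by at most [spread * h]. *)
Let spread : R := `|c i0|^-1 * \sum_(i | i != i0) `|c i|.

Let spread_ge0 : 0 <= spread.
Proof. by rewrite mulr_ge0 ?invr_ge0 ?normr_ge0 // sumr_ge0. Qed.

Let measurable_level : measurable level.
Proof. exact: measurable_linear_combination_level. Qed.

Section cells.
Context (h : R) (h_gt0 : 0 < h).

(* Collapsing the coordinate [i0] to [0] makes the cells partition the space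
   according to the other coordinates only, while keeping a single index type. *)
Let quant (i : I) (x : R) : int := if i == i0 then 0 else Num.floor (x / h).

Let slab (z : I -> int) (i : I) : set R := [set x | quant i x = z i].

Let measurable_slab z i : measurable (slab z i).
Proof.
rewrite /slab /quant; case: eqP => _.
  have [e|ne] := pselect (0 = z i).
    by rewrite (_ : [set _ | _] = setT) //; apply/seteqP; split.
  by rewrite (_ : [set _ | _] = set0) //; apply/seteqP; split.
rewrite (_ : [set _ | _] = `[(z i)%:~R * h, (z i + 1)%:~R * h[%classic) //.
apply/seteqP; split => x /=; rewrite in_itv /=.
  by move/eqP; rewrite floor_eq ler_pdivlMr // ltr_pdivrMr.
by move=> H; apply/eqP; rewrite floor_eq ler_pdivlMr // ltr_pdivrMr.
Qed.

Let cell (z : I -> int) : set T :=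
  \bigcap_(i in [set` [set: I]%SET]) Z i @^-1` slab z i.

Let measurable_preimageRV (X : {RV P >-> R}) (A : set R) :
  measurable A -> measurable (X @^-1` A).
Proof. by move=> mA; have := measurable_funP X measurableT A mA; rewrite setTI. Qed.

Let measurable_cell z : measurable (cell z).
Proof.
apply: fin_bigcap_measurable => [|i _]; first exact: finite_finset.
exact: measurable_preimageRV.
Qed.

(** Solving the level equation for [Z i0], the deviation from [a] is a weighted sum of rounding
    errors, each in [[0, h)]. *)
Let level_cell z w : level w -> cell z w ->
  let a := (t - \sum_(i | i != i0) c i * ((z i)%:~R * h)) / c i0 in
  `[a - spread * h, a + spread * h]%classic (Z i0 w).
Proof.
move=> lw cw a; rewrite /= in_itv /= -ler_distl.
have -> : Z i0 w - a =
    - (c i0)^-1 * \sum_(i | i != i0) c i * (Z i w - (z i)%:~R * h).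
  rewrite (eq_bigr (fun i => c i * Z i w - c i * ((z i)%:~R * h))); last first.
    by move=> i _; rewrite mulrBr.
  rewrite sumrB /a -lw (bigD1 i0) //=.
  by field.
rewrite normrM normrN normfV /spread -mulrA ler_wpM2l ?invr_ge0 //.
rewrite mulr_suml (le_trans (ler_norm_sum _ _ _)) // ler_sum // => i ii0.
rewrite normrM ler_wpM2l //.
have := cw i; rewrite /= finset.in_setT => /(_ isT).
rewrite /slab /= /quant (negbTE ii0) => /eqP.
rewrite floor_eq ler_pdivlMr // ltr_pdivrMr // intrD mulrDl mul1r => /andP[h1 h2].
by rewrite ger0_norm ?subr_ge0 // lerBlDl ltW.
Qed.

(* On a cell the level set forces [Z i0] into a short interval, an event
   independent of the cell. *)
Let prob_level_cell z :
  (P (level `&` cell z) <= (K * (spread * h))%:E * P (cell z))%E.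
Proof.
set a := (t - \sum_(i | i != i0) c i * ((z i)%:~R * h)) / c i0.
set ball := `[a - spread * h, a + spread * h]%classic.
(* Only the [i0] factor is tightened, so the enlarged event is still a product and independence
   applies to it. *)
pose slab' i := if i == i0 then slab z i `&` ball else slab z i.
have mslab' i : measurable (slab' i).
  by rewrite /slab'; case: ifP => _ //; apply: measurableI => //;
     exact: measurable_itv.
apply: (@le_trans _ _
    (P (\bigcap_(i in [set` [set: I]%SET]) (Z i @^-1` slab' i)))).
  apply: le_measure; rewrite ?inE.
  - exact: measurableI.
  - apply: fin_bigcap_measurable => [|i _]; first exact: finite_finset.
    exact: measurable_preimageRV.
  - move=> w [lw cw] i _ /=; rewrite /slab'.
    have slabw : slab z i (Z i w) by apply: cw; rewrite /= finset.in_setT.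
    by case: eqP => // ei; split => //; rewrite ei; exact: level_cell.
rewrite /cell !indepZ // !(prode_setT_D1 _ i0) muleA.
rewrite [X in (_ * X <= _)%E](eq_bigr (fun i => P (Z i @^-1` slab z i)));
  last by move=> i /negbTE ii0; rewrite /slab' ii0.
apply: lee_wpmul2r; first by apply: prode_ge0 => i _; exact: measure_ge0.
rewrite /slab' eqxx /slab /quant eqxx.
(* As [quant] vanishes at [i0], a label with [z i0] nonzero has an empty cell; otherwise the slab at
   [i0] is the whole line. *)
have [e|ne] := pselect (0 = z i0); last first.
  have -> : Z i0 @^-1` ([set _ | 0 = z i0] `&` ball) = set0.
    by apply/seteqP; split => // w [].
  rewrite measure0; apply: mule_ge0; last exact: measure_ge0.
  by rewrite lee_fin mulr_ge0 // mulr_ge0 // ltW.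
have -> : [set _ : R | 0 = z i0] = setT by apply/seteqP; split.
rewrite preimage_setT probability_setT mule1 setTI.
by apply: Z_conc; rewrite mulr_ge0 // ltW.
Qed.

(** Cell labels are integer functions on a finite type, hence countable; coding them by naturals
    makes countable additivity applicable. *)
Let index (w : T) : nat := pickle [ffun i => quant i (Z i w)].

(** The test on [pickle] is needed because [unpickle] may also decode numbers that are not codes. *)
Let indexE m : index @^-1` [set m] =
  if unpickle m is Some z then
    if pickle (z : {ffun I -> int}) == m then cell z else set0
  else set0.
Proof.
apply/seteqP; split => w /=.
  move=> <-; rewrite /index pickleK eqxx => i _ /=.
  by rewrite /slab /= ffunE.
case: unpickle => // z; case: eqP => // <- cw.
congr pickle; apply/ffunP => i; rewrite ffunE.
by apply: cw; rewrite /= finset.in_setT.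
Qed.

Let measurable_index m : measurable (index @^-1` [set m]).
Proof. by rewrite indexE; case: unpickle => // z; case: ifP. Qed.

(** The bounds on the cells are summed; the cells partition the space, so their probabilities add up
    to 1. *)
Lemma prob_level_le : (P level <= (K * (spread * h))%:E)%E.
Proof.
have cover : \bigcup_m index @^-1` [set m] = setT.
  by apply/seteqP; split => // w _; exists (index w).
have tI : trivIset setT (fun m => index @^-1` [set m]).
  exact: trivIset_preimage1.
rewrite -[level]setIT -cover setI_bigcupr measure_bigcup //; last 2 first.
- by move=> m _; exact: measurableI.
- exact: trivIset_setIl.
apply: (@le_trans _ _ (\sum_(m <oo | m \in [set: nat])
    ((K * (spread * h))%:E * P (index @^-1` [set m])))%E).
  apply: lee_nneseries => [m _ _|m _]; first exact: measure_ge0.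
  rewrite indexE; case: unpickle => [z|]; last by rewrite setI0 !measure0 mule0.
  case: ifP => _; last by rewrite setI0 !measure0 mule0.
  exact: prob_level_cell.
rewrite nneseriesZl; last by move=> m _; exact: measure_ge0.
by rewrite -measure_bigcup // cover [X in (_ * X)%E](probability_setT P) mule1.
Qed.

End cells.

Lemma prob_linear_combination_eq0 : P [set w | \sum_i c i * Z i w = t] = 0%E.
Proof.
apply/eqP; rewrite eq_le measure_ge0 andbT.
apply/lee_addgt0Pr => e e0; rewrite add0e.
have Ks : 0 <= K * spread by rewrite mulr_ge0.
(* This mesh makes the bound at most [e]; the added 1 keeps the denominator positive when
   [K * spread] is 0. *)
have h0 : 0 < e / (K * spread + 1) by rewrite divr_gt0 // ltr_wpDl.
apply: le_trans (prob_level_le h0) _; rewrite lee_fin.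
rewrite mulrA; move: Ks; set C := K * spread => C0.
rewrite mulrA ler_pdivrMr; last by rewrite ltr_wpDl.
by rewrite mulrC ler_pM2l // lerDl.
Qed.

End concentrated_combination.

(** * Almost sure avoidance of the exceptional values *)

(** Each row has squared norm 1, a diagonal entry of [A *m A^T]. *)
Lemma orthogonal_mx_row_neq0 (R : realType) (n : nat) (A : 'M[R]_n) (i : 'I_n) :
  orthogonal_mx A -> exists a, A i a != 0.
Proof.
move=> /mulmx1C /matrixP /(_ i i) AAt; apply: contrapT => A0; move: AAt.
rewrite !mxE eqxx big1 => [/esym/eqP|a _]; first by rewrite oner_eq0.
have [->|Aa] := eqVneq (A i a) 0; first by rewrite mul0r.
by case: A0; exists a.
Qed.

Lemma orthogonal_mx_col_neq0 (R : realType) (n : nat) (A : 'M[R]_n) (j : 'I_n) :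
  orthogonal_mx A -> exists b, A b j != 0.
Proof.
move=> oA; have [|b] := @orthogonal_mx_row_neq0 _ _ A^T j.
  by rewrite /orthogonal_mx trmxK; exact: mulmx1C.
by rewrite mxE; exists b.
Qed.

(** The coefficient of [Y a b] in the entry is [P i a * Q b j], which is nonzero for a suitable pair
    [(a, b)]. *)
Lemma ae_transformed_entry_neq (R : realType) (d : measure_display)
    (T : measurableType d) (Pr : probability T R) (n k : nat) (sigma : R)
    (X : 'M[R]_(n, k)) (Y : 'I_n -> 'I_k -> {RV Pr >-> R})
    (P : 'M[R]_n) (Q : 'M[R]_k) (i : 'I_n) (j : 'I_k) (t : R) :
  0 < sigma ->
  (forall i j, normal_rv (Y i j) (X i j) sigma) ->
  mutually_independent (fun ij : 'I_n * 'I_k => Y ij.1 ij.2) ->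
  orthogonal_mx P -> orthogonal_mx Q ->
  {ae Pr, forall w, (P *m realization Y w *m Q) i j != t}.
Proof.
move=> s0 nY iY oP oQ.
have [a Pa] := orthogonal_mx_row_neq0 i oP.
have [b Qb] := orthogonal_mx_col_neq0 j oQ.
have E w : (P *m realization Y w *m Q) i j =
    \sum_(p : 'I_n * 'I_k) P i p.1 * Q p.2 j * Y p.1 p.2 w.
  rewrite mxE -(pair_bigA _ (fun a b => P i a * Q b j * Y a b w)) exchange_big /=.
  apply: eq_bigr => v _; rewrite mxE mulr_suml; apply: eq_bigr => u _.
  by rewrite !mxE mulrAC.
have null : Pr [set w | \sum_(p : 'I_n * 'I_k)
    P i p.1 * Q p.2 j * Y p.1 p.2 w = t] = 0%E.
  apply: (@prob_linear_combination_eq0 _ _ _ _ _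
    (fun ij : 'I_n * 'I_k => Y ij.1 ij.2) (a, b) (normal_peak sigma * 2)
    (fun p => P i p.1 * Q p.2 j)) => //=.
  - by rewrite mulr_ge0 ?normal_peak_ge0.
  - move=> x r r0; have := nY a b _ (measurable_itv `[x - r, x + r]).
    rewrite /distribution /pushforward => ->.
    by rewrite -mulrA; apply: normal_prob_itv_le; rewrite ?gt_eqF.
  - by rewrite mulf_neq0.
exists [set w | \sum_(p : 'I_n * 'I_k) P i p.1 * Q p.2 j * Y p.1 p.2 w = t].
split; [|exact: null|by move=> w /= /negP/negPn/eqP <-; rewrite E].
exact: measurable_linear_combination_level.
Qed.

Theorem proposition12 (R : realType) (d : measure_display)
    (T : measurableType d) (Pr : probability T R) (n k : nat) (sigma : R)
    (hsigma : 0 < sigma) (X : 'M[R]_(n, k))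
    (Y : 'I_n -> 'I_k -> {RV Pr >-> R})
    (hYnormal : forall i j, normal_rv (Y i j) (X i j) sigma)
    (hYindep : mutually_independent (fun ij : 'I_n * 'I_k => Y ij.1 ij.2))
    (P : 'M[R]_n) (Q : 'M[R]_k)
    (hP : orthogonal_mx P) (hQ : orthogonal_mx Q) :
  {ae Pr, forall w,
    argmin setT (fun Theta => SURE sigma P Q Theta (realization Y w)) =
      [set ones R n *m (ones R k)^T -
           map_mx (fun y => sigma ^+ 2 / y)
             (hadamard (P *m realization Y w *m Q)
                       (P *m realization Y w *m Q))]
    /\
    argmin (@binary_mx R n k)
        (fun Theta => SURE sigma P Q Theta (realization Y w)) =
      [set map_mx
             (\1_(~` `[- (Num.sqrt 2 * sigma), Num.sqrt 2 * sigma]%classic))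
             (P *m realization Y w *m Q)]}.
Proof.
have ae_neq s : {ae Pr, forall w, forall i j, (P *m realization Y w *m Q) i j != s}.
  apply: filter_forall => i; apply: filter_forall => j.
  exact: (ae_transformed_entry_neq i j s hsigma hYnormal hYindep hP hQ).
(* At the value 0 the real entry problem is affine with nonzero slope and has no minimizer; at the
   other two values the binary choices tie. *)
apply: filterS3 (ae_neq 0) (ae_neq (Num.sqrt 2 * sigma))
  (ae_neq (- (Num.sqrt 2 * sigma))) => w M0 Mp Mn; split.
  exact: argmin_SURE_setT.
apply: argmin_SURE_binary => // i j.
by rewrite eqr_norml negb_and negb_or Mp Mn.
Qed.
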